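(* Let $G=\prod_{n\in\mathbb{Z}}G_n$ be the unrestricted Cartesian product of groups $G_n$ ($n\in\mathbb{Z}$), each isomorphic to the dihedral group $D_8$ of order $8$. Then no integral of $G$ is residually finite.
   Context: For a group $H$, $H'$ denotes the derived group (the abstract subgroup generated by all commutators). An integral of a group $G$ is a group $H$ with $H'\cong G$ (isomorphism of abstract groups). *)

(* Defs.v *)
From HB Require Import structures.
From mathcomp Require Import all_boot fingroup.
From mathcomp Require Import boolp classical_sets.

Set Implicit Arguments.
Unset Strict Implicit.
Unset Printing Implicit Defensive.

Local Open Scope classical_set_scope.
Local Open Scope group_scope.

(* MathComp's groupType is the structure of arbitrary, possibly infinite,
   abstract groups. It extends choiceType, which costs no generality here:
   under the axioms of boolp every type is a choiceType (gen_choiceMixin). *)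

Definition isomorphic (G H : groupType) : Prop :=
  exists f : {multiplicative G -> H}, bijective f.

Section CartesianProduct.
Variables (I : Type) (G : I -> groupType).

Definition cartesian_product : Type := forall i, G i.

HB.instance Definition _ := Choice.copy cartesian_product (forall i, G i).

Implicit Types x y : cartesian_product.

Let one : cartesian_product := fun i => 1.
Let mul x y : cartesian_product := fun i => x i * y i.
Let inv x : cartesian_product := fun i => (x i)^-1.

Fact cartesian_product_mulA : associative mul.
Proof. by move=> x y z; apply: functional_extensionality_dep => i; apply: mulgA. Qed.

Fact cartesian_product_mul1g : left_id one mul.
Proof. by move=> x; apply: functional_extensionality_dep => i; apply: mul1g. Qed.

Fact cartesian_product_mulg1 : right_id one mul.
Proof. by move=> x; apply: functional_extensionality_dep => i; apply: mulg1. Qed.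

Fact cartesian_product_mulVg : left_inverse one inv mul.
Proof. by move=> x; apply: functional_extensionality_dep => i; apply: mulVg. Qed.

Fact cartesian_product_mulgV : right_inverse one inv mul.
Proof. by move=> x; apply: functional_extensionality_dep => i; apply: mulgV. Qed.

HB.instance Definition _ := isGroup.Build cartesian_product
  cartesian_product_mulA cartesian_product_mul1g cartesian_product_mulg1
  cartesian_product_mulVg cartesian_product_mulgV.

End CartesianProduct.

Section DerivedGroup.
Variable H : groupType.

Definition is_subgroup (A : set H) : Prop :=
  A 1 /\ forall x y : H, A x -> A y -> A (x / y).

Definition commutators : set H := [set c | exists x y : H, c = [~ x, y]].

Definition derived_set : set H := smallest is_subgroup commutators.

Definition derived_pred : {pred H} := fun x => `[< derived_set x >].

Fact derived_group_closed : group_closed derived_pred.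
Proof.
split; first by apply/asboolP => A [[]].
move=> x y /asboolP Dx /asboolP Dy; apply/asboolP => A [sA cA].
by apply: sA.2; [apply: Dx | apply: Dy].
Qed.

Record derived_group := DerivedGroup {
  derived_val : H;
  derived_valP : derived_val \in derived_pred
}.

HB.instance Definition _ := [isSub for derived_val].
HB.instance Definition _ := [Choice of derived_group by <:].
HB.instance Definition _ :=
  SubChoice_isSubGroup.Build H derived_pred derived_group derived_group_closed.

End DerivedGroup.

Definition is_integral (H G : groupType) : Prop :=
  isomorphic (derived_group H) G.

Definition residually_finite (H : groupType) : Prop :=
  forall x : H, x <> 1 ->
    exists (K : finGroupType) (f : {multiplicative H -> K}), f x <> 1.

(* Main.v *)
Require Import Defs.
From HB Require Import structures.
From mathcomp Require Import all_boot all_order all_algebra all_fingroup all_solvable.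
From mathcomp Require Import boolp.

(** The dihedral group of order 8 is itself no derived group: the commutators
of a group H whose derived subgroup is D8 act trivially on the characteristic
cyclic subgroup of order 4, as the automorphism group of the latter is abelian,
whereas a reflection inverts it. For the product P of copies of D8 indexed by
I, the factors may be permuted by H, and the argument becomes a dichotomy on
the orbits.

Let H be a group whose derived subgroup is P. The elements g with g ^+ 2 <> 1
all of whose commutators lie in {1, g ^+ 2} are exactly the axial ones: those
that are a rotation of order 4 in one coordinate and central in all others
(axialP). The description mentions the group structure only, so H permutes
the axial elements by conjugation, and hence permutes the index set I
(move_axis). Moreover h turns the rotation of axis n into the one of its image
axis or into the inverse (flip), so h acts by a signed permutation of I. The
elements of P fix all axes; thus the permutations induced by H commute.
An automorphism of P can modify an axial element by central factors in other
coordinates; that such factors never come back to the axis, even when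
infinitely many coordinates are involved, is automorphism_center_coordinate.

If H is residually finite, every h in H has finite orbits on I
(residually_finite_periodic). Otherwise, take an infinite orbit through i, and
a finite quotient in which the central involution of the i-th factor survives;
some power t of h is trivial there. Put the central involution at all positions
of the forward t-orbit of i, and 1 elsewhere. Since the product is
unrestricted, this is an element w of P, and the commutator of w with t
telescopes to the involution of the i-th factor, which therefore dies in the
quotient.

If all orbits of single elements are finite, then finitely many elements of H
always have a common finite stable set through any given i, because their
permutations commute (periodic_stable). On the finite sets stable under a
given element, the product of the signs is multiplicative, like the product of
the nonzero entries of a signed permutation matrix (sign_mul). A product of
commutators thus has trivial sign on each finite set stable under the elements
that occur in it (derived_sign_trivial). But the element of P that is a
reflection at i and trivial elsewhere flips the axis i and no other one, so its
sign is nontrivial on any finite set containing i: it cannot belong to the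
derived subgroup, a contradiction. *)

Set Implicit Arguments.
Unset Strict Implicit.
Unset Printing Implicit Defensive.

(** * Morphisms and isomorphisms of groups *)

Section Morphisms.
Local Open Scope group_scope.

(** The structure {multiplicative _ -> _} records the product only; this gives
access to the lemmas on morphisms that preserve the unit as well. *)
Lemma morph_umagma (G H : groupType) (f : G -> H) :
  {morph f : x y / x * y} ->
  exists g : UMagmaMorphism.type G H, g = f :> (G -> H).
Proof.
move=> fM.
have f1 : f 1 = 1 by apply: (mulgI (f 1)); rewrite -fM !mulg1.
pose iM := isMultiplicative.Build G H f fM.
pose i1 := Multiplicative_isUMagmaMorphism.Build G H f f1.
pose g : UMagmaMorphism.type G H := HB.pack f iM i1.
by exists g.
Qed.

Lemma isomorphic_of_morph (G H : groupType) (f : G -> H) :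
  {morph f : x y / x * y} -> bijective f -> isomorphic G H.
Proof.
by move=> /morph_umagma[g <-] bg; exists (g : {multiplicative G -> H}).
Qed.

Lemma isomorphic_sym (G H : groupType) : isomorphic G H -> isomorphic H G.
Proof.
case=> f [g fK gK]; apply: (@isomorphic_of_morph _ _ g); last by exists f.
exact: can2_gmulfM fK gK.
Qed.

Lemma isomorphic_trans (G H K : groupType) :
  isomorphic G H -> isomorphic H K -> isomorphic G K.
Proof.
by case=> f bf [g bg]; exists (g \o f); apply: bij_comp.
Qed.

Lemma isomorphic_prod (I : Type) (G K : I -> groupType) :
  (forall i, isomorphic (G i) (K i)) ->
  isomorphic (cartesian_product G) (cartesian_product K).
Proof.
move=> iso; pose f i := sval (cid (iso i)).
have [g fg] : exists g : forall i, K i -> G i,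
    forall i, cancel (f i) (g i) /\ cancel (g i) (f i).
  suff /(_ _)/cid gP i : exists h, cancel (f i) h /\ cancel h (f i).
    by exists (fun i => sval (gP i)) => i; exact: svalP (gP i).
  by rewrite /f; case: (cid (iso i)) => /= fi [h hK Kh]; exists h.
apply: (@isomorphic_of_morph _ _
  (fun x : cartesian_product G => (fun i => f i (x i)) : cartesian_product K)).
  by move=> x y; apply: functional_extensionality_dep => i; exact: gmulfM.
exists (fun y i => g i (y i)) => x; apply: functional_extensionality_dep => i.
  exact: (fg i).1.
exact: (fg i).2.
Qed.
End Morphisms.

(** * The dihedral group of order 8 *)

Section D8.
Local Open Scope group_scope.

(** A rotation r of order 4 and a reflection s of D8. The last clause, that all
elements other than r and r^-1 have square 1, determines the centralizer of r
and the center of D. *)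
Definition dihedral_pair (D : groupType) (r s : D) : Prop :=
  [/\ r ^+ 4 = 1, r ^+ 2 <> 1, [~ r, s] = r ^+ 2
    & forall a : D, a ^+ 2 <> 1 -> a = r \/ a = r^-1].

Lemma isog_D8_dihedral_pair (gT : finGroupType) :
  [set: gT] \isog [set: 'D_8] -> exists r s : gT, dihedral_pair r s.
Proof.
move=> isoG.
have [[x y] genG [_ xy]] := @generators_2dihedral _ [set: gT]%G 3 isT isoG.
have [[_ out _] _ _ _ _] := @dihedral2_structure _ _ 3 x y isT genG isoG.
have {genG} [_ _ /= ox _] := genG.
have x4 : x ^+ 4 = 1 by apply/eqP; rewrite -order_dvdn ox.
have x3 : x ^+ 3 = x^-1 by apply: (mulgI x); rewrite -expgS x4 mulgV.
exists x, y; split => //.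
- by move/eqP; rewrite -order_dvdn ox.
- by rewrite commgEl xy -x3; apply: (mulgI x); rewrite mulgA -!expgS x4 mul1g.
move=> a /eqP; rewrite -order_dvdn => a2.
have /cyclePmin[i lti def_a] : a \in <[x]>.
  apply: contraNT a2 => aX.
  have : a \in [set: gT] :\: <[x]> by rewrite !inE aX.
  by move/out => ->.
move: a2; rewrite order_dvdn def_a -x3; move: lti; rewrite ox.
case: i {def_a} => [|[|[|[|]]]] //= _; rewrite ?expg1n ?eqxx //; try by auto.
by rewrite -expgnA x4 eqxx.
Qed.
End D8.

Section DihedralPair.
Local Open Scope group_scope.
Variables (D : groupType) (r s : D).
Hypothesis rsP : dihedral_pair r s.

Let z := r ^+ 2.
Let r4 : r ^+ 4 = 1. Proof. by case: rsP. Qed.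
Let z_neq1 : z <> 1. Proof. by case: rsP. Qed.
Let rs : [~ r, s] = z. Proof. by case: rsP. Qed.

(** The two elements of the center of D; see in_center_commute and
in_center_of_commg1. *)
Definition in_center (a : D) : Prop := a = 1 \/ a = z.

(** Rotations of order 4 are from now on recognised by a ^+ 2 <> 1, a condition
that automorphisms preserve. *)
Lemma rotationP a : a ^+ 2 <> 1 <-> a = r \/ a = r^-1.
Proof.
split=> [|[]->]; first by case: rsP => _ _ _; apply.
  exact: z_neq1.
by rewrite expVgn => /eqP; rewrite invg_eq1 => /eqP.
Qed.

Lemma z_sq : z * z = 1.
Proof. by rewrite -expgnDr. Qed.

Lemma z_inv : z^-1 = z.
Proof. exact: mulg1_eq z_sq. Qed.

Lemma r_inv : r^-1 = r * z.
Proof. by apply: mulg1_eq; rewrite -expgS -expgS. Qed.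

Lemma r_inv_neq : r^-1 <> r.
Proof.
by rewrite r_inv => /(congr1 ( *%g r^-1)); rewrite mulKg mulVg; apply: z_neq1.
Qed.

Lemma rotation_sq a : a ^+ 2 <> 1 -> a ^+ 2 = z.
Proof. by case/rotationP => ->; rewrite ?expVgn ?z_inv. Qed.

Lemma rotationJ (a b : D) : a ^+ 2 <> 1 -> (a ^ b) ^+ 2 <> 1.
Proof. by move=> a2 /eqP; rewrite -conjXg conjg_eq1 => /eqP. Qed.

(** Any conjugate of r is again a rotation of order 4, so it has the same
square as r. *)
Lemma z_central (a : D) : commute z a.
Proof.
apply/commgP/conjg_fixP; rewrite conjXg rotation_sq //.
exact/rotationJ/z_neq1.
Qed.

Lemma in_center_commute (a b : D) : in_center a -> commute a b.
Proof.
by case=> ->; [apply: commute_sym; apply: commute1|apply: z_central].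
Qed.

Lemma in_center_sq a : in_center a -> a ^+ 2 = 1.
Proof. by case=> ->; rewrite ?expg1n // expg2 z_sq. Qed.

Lemma rotation_commg (a b : D) : a ^+ 2 <> 1 -> in_center [~ a, b].
Proof.
move=> a2; rewrite commgEl /in_center.
have /rotationP[] := a2; have /rotationP[] := rotationJ (b := b) a2 => -> ->.
- by left; rewrite mulVg.
- by right; rewrite {2}r_inv mulKg.
- by right; rewrite invgK.
- by left; rewrite mulVg.
Qed.

(** If a commutes with r and a ^+ 2 = 1, then r * a has the same square as r,
so it is r or r^-1. *)
Lemma centraliser_rotation a : commute r a ->
  a = r \/ a = r^-1 \/ in_center a.
Proof.
move=> ra; have [/eqP a2|/eqP/rotationP[]] := boolP (a ^+ 2 == 1); last 2 first.
- by left.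
- by right; left.
right; right; have /rotationP[e|e] : (r * a) ^+ 2 <> 1.
  by rewrite expgMn // a2 mulg1.
  by left; apply: (mulgI r); rewrite mulg1.
by right; apply: (mulgI r); rewrite e r_inv.
Qed.

Lemma centraliser_rotation_commute (a b : D) :
  commute r a -> commute r b -> commute a b.
Proof.
move=> ra rb; have [->|[->|/in_center_commute]] // := centraliser_rotation ra.
by apply: commute_sym; apply: commuteV; apply: commute_sym.
Qed.

Lemma in_center_of_commg1 a : (forall b, [~ a, b] = 1) -> in_center a.
Proof.
move=> a_central.
have nr : [~ r, s] <> 1 by rewrite rs.
have /centraliser_rotation[a_r|[a_r|//]] : commute r a.
- by apply: commute_sym; apply/commgP/eqP.
- by move: (a_central s); rewrite a_r.
case: nr; apply/eqP/commgP; rewrite -[r]invgK -a_r.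
by apply: commute_sym; apply: commuteV; apply: commute_sym; apply/commgP/eqP.
Qed.

(** * Axial elements of a power of D *)

Variable I : choiceType.
Notation P := (cartesian_product (fun _ : I => D)).

Definition delta (n : I) (a : D) : P := fun m => if m == n then a else 1.

Lemma deltaE n a : delta n a n = a.
Proof. by rewrite /delta eqxx. Qed.

Lemma delta_neq n m a : m <> n -> delta n a m = 1.
Proof. by rewrite /delta; case: eqP. Qed.

Lemma deltaV n a : delta n a^-1 = (delta n a)^-1.
Proof.
apply: functional_extensionality_dep => m.
change (delta n a^-1 m = (delta n a m)^-1).
by rewrite /delta; case: eqP; rewrite ?invg1.
Qed.

Lemma prodX (x : P) k n : (x ^+ k) n = x n ^+ k.
Proof.
elim: k => [//|k IH]; rewrite !expgS -IH.
by [].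
Qed.

Lemma deltaX n a k : delta n a ^+ k = delta n (a ^+ k).
Proof.
apply: functional_extensionality_dep => m.
by rewrite prodX /delta; case: eqP; rewrite ?expg1n.
Qed.

(** A rotation of order 4 around one axis, up to central factors. *)
Definition axial (n : I) (g : P) : Prop :=
  (g n) ^+ 2 <> 1 /\ forall m, m <> n -> in_center (g m).

Lemma axial_at n m g : axial n g -> (g m) ^+ 2 <> 1 -> m = n.
Proof.
by case=> _ gs gm; apply: contrapT => /gs/in_center_sq.
Qed.

Lemma axial_delta n : axial n (delta n r).
Proof.
by split=> [|m mn]; rewrite ?deltaE ?delta_neq //; left.
Qed.

(** Being axial for some axis is a property of the abstract group: an element
with two noncentral coordinates has nontrivial commutators supported at each of
them, so these are not all equal. *)
Lemma axialP g : (exists n, axial n g) <->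
  g ^+ 2 <> 1 /\ forall x, [~ g, x] = 1 \/ [~ g, x] = g ^+ 2.
Proof.
split=> [[n [gn gs]]|[g2 gx]].
  split=> [/(congr1 (@^~ n))|x]; first by rewrite prodX.
  have gxm m : m <> n -> [~ g, x] m = 1.
    by move=> /gs/in_center_commute-/(_ (x m))/commgP/eqP.
  have [e|e] := rotation_commg (x n) gn; [left|right];
    apply: functional_extensionality_dep => m;
    (have [->|/eqP mn] := eqVneq m n; first by
      rewrite ?prodX ?(rotation_sq gn)).
    exact: gxm.
  by rewrite gxm // prodX in_center_sq //; apply: gs.
have [n gn] : exists n, (g n) ^+ 2 <> 1.
  apply: contrapT => /forallNP gn; apply: g2.
  apply: functional_extensionality_dep => n; rewrite prodX.
  exact: contrapT (gn n).
exists n; split=> // m mn; apply: in_center_of_commg1 => b.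
(* The commutator with delta m b is trivial at n, where g ^+ 2 is not. *)
have := gx (delta m b); case=> [/(congr1 (@^~ m))|/(congr1 (@^~ n))].
  by change ([~ g m, delta m b m] = 1 -> [~ g m, b] = 1); rewrite deltaE.
change ([~ g n, delta m b n] = (g ^+ 2) n -> [~ g m, b] = 1).
by rewrite delta_neq ?commg1 ?prodX => // [/esym|/esym].
Qed.

(** * Automorphisms of a power of D *)

Section Automorphism.
Variable alpha : P -> P.
Hypothesis alphaM : {morph alpha : x y / x * y}.
Hypothesis alpha_inj : injective alpha.
Hypothesis alpha_surj : forall y, exists x, alpha x = y.

Let alphaX k : {morph alpha : x / x ^+ k}.
Proof. by have [a <-] := morph_umagma alphaM; apply: gmulfXn. Qed.
Let alphaV : {morph alpha : x / x^-1}.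
Proof. by have [a <-] := morph_umagma alphaM; apply: gmulfV. Qed.
Let alphaR : {morph alpha : x y / [~ x, y]}.
Proof. by have [a <-] := morph_umagma alphaM; apply: gmulfR. Qed.
Let alpha1 : alpha 1 = 1.
Proof. by have [a <-] := morph_umagma alphaM; apply: gmulf1. Qed.

Lemma automorphism_axial n g : axial n g -> exists m, axial m (alpha g).
Proof.
move=> g_axial; have /axialP[g2 gx] : exists n, axial n g by exists n.
apply/axialP; split=> [|y].
  by rewrite -alphaX -[1]alpha1 => /alpha_inj.
have [x <-] := alpha_surj y.
by rewrite -alphaX -alphaR; have [->|->] := gx x; [left; rewrite alpha1|right].
Qed.

(** The product being unrestricted, each central element is a single
commutator, with factors that are trivial wherever the element is. *)
Lemma center_commutator (w : P) : (forall k, in_center (w k)) ->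
  exists x y : P, [/\ w = [~ x, y],
    forall k, w k = 1 -> x k = 1 & forall k, w k = 1 -> y k = 1].
Proof.
move=> w_center.
exists (fun k => if w k == 1 then 1 else r).
exists (fun k => if w k == 1 then 1 else s).
split=> [|k ->|k ->]; rewrite ?eqxx //.
apply: functional_extensionality_dep => k.
change (w k = [~ if w k == 1 then 1 else r, if w k == 1 then 1 else s]).
case: eqP => [->|wk]; first by rewrite commg1.
by rewrite rs; case: (w_center k).
Qed.

(** The images of two elements that commute with g commute with alpha g, hence
with r at the coordinate m, and so they commute with each other there. Writing
w as a commutator of two elements trivial at n, hence commuting with g, gives
the result; multiplicativity of alpha alone would not, as w can have infinite
support. *)
Lemma automorphism_center_coordinate1 n m (g w : P) :
    axial n g -> axial m (alpha g) ->
    (forall k, in_center (w k)) -> w n = 1 -> alpha w m = 1.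
Proof.
move=> [_ gs] [agm _] w_center wn.
have [x [y [w_xy xn yn]]] := center_commutator w_center.
have r_comm (u : P) : u n = 1 -> commute r (alpha u m).
  move=> un; have gu : commute g u.
    apply: functional_extensionality_dep => k.
    change (commute (g k) (u k)).
    have [->|/eqP kn] := eqVneq k n; first by rewrite un; apply: commute1.
    exact/in_center_commute/gs.
  have : commute (alpha g m) (alpha u m).
    by have := congr1 (fun v => alpha v m) gu; rewrite !alphaM.
  have /rotationP[-> //|->] := agm.
  by move=> /commute_sym/commuteV/commute_sym; rewrite invgK.
rewrite w_xy alphaR; apply/eqP/commgP.
by apply: centraliser_rotation_commute; apply: r_comm; [apply: xn|apply: yn].
Qed.

(** Up to central factors outside the axis, which do not reach the new axis,
g is delta n r or its inverse. *)
Lemma automorphism_axial_coordinate n m (g : P) :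
    axial m (alpha (delta n r)) -> axial n g ->
  axial m (alpha g) /\
  alpha g m = if alpha (delta n r) m == r then g n else (g n)^-1.
Proof.
move=> ar_axial g_axial; have [gn gs] := g_axial.
pose w : P := fun k => if k == n then 1 else g k.
have g_w : g = delta n (g n) * w.
  apply: functional_extensionality_dep => k.
  change (g k = delta n (g n) k * w k); rewrite /delta /w.
  by case: eqP => [->|]; rewrite ?mulg1 ?mul1g.
have aw : alpha w m = 1.
  apply: (automorphism_center_coordinate1 (axial_delta n) ar_axial) => [k|].
    by rewrite /w; case: eqP => [_|/gs //]; left.
  by rewrite /w eqxx.
have ag : alpha g m = alpha (delta n (g n)) m.
  rewrite [in LHS]g_w alphaM.
  change (alpha (delta n (g n)) m * alpha w m = alpha (delta n (g n)) m).
  by rewrite aw mulg1.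
have {}ag : alpha g m = if alpha (delta n r) m == r then g n else (g n)^-1.
  rewrite ag; have [/rotationP ar_m _] := ar_axial.
  have /rotationP[->|->] := gn; last rewrite deltaV alphaV invgK.
    by case: eqP ar_m => [->//|] ? [].
  change ((alpha (delta n r) m)^-1 =
    if alpha (delta n r) m == r then r^-1 else r).
  by case: eqP ar_m => [->//|] ? [] // ->; rewrite invgK.
split=> //; have [k ag_axial] := automorphism_axial g_axial.
suff -> : m = k by [].
apply: (axial_at ag_axial); rewrite ag; case: ifP => // _.
by rewrite expVgn => /eqP; rewrite invg_eq1 => /eqP.
Qed.

Lemma automorphism_center_coordinate n m (w : P) :
    axial m (alpha (delta n r)) -> (forall k, in_center (w k)) ->
  alpha w m = w n.
Proof.
move=> ar_axial w_center.
have aw u := automorphism_center_coordinate1 (w := u) (axial_delta n) ar_axial.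
have [wn|wn] := w_center n; first by rewrite wn; apply: aw.
pose u : P := fun k => if k == n then 1 else w k.
have w_u : w = delta n r ^+ 2 * u.
  apply: functional_extensionality_dep => k; rewrite deltaX.
  change (w k = delta n z k * u k); rewrite /delta /u.
  by case: eqP => [->|]; rewrite ?mulg1 ?mul1g.
rewrite [in LHS]w_u alphaM alphaX.
change ((alpha (delta n r) ^+ 2) m * alpha u m = w n).
rewrite aw ?mulg1 /u ?eqxx // => [|k].
  by rewrite prodX wn (rotation_sq ar_axial.1).
by case: eqP => // _; left.
Qed.

End Automorphism.

(** * The signed action on the axes *)

Section Integral.
Variables (H : groupType) (phi : {multiplicative P -> H}).
Hypothesis phi_inj : injective phi.
Hypothesis phi_derived : forall x : H, derived_set x <-> exists y, phi y = x.

Let phiJ : {morph phi : x y / x ^ y}.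
Proof. by have [a <-] := morph_umagma (@gmulfM _ _ phi); apply: gmulfJ. Qed.
Let phiV : {morph phi : x / x^-1}.
Proof. by have [a <-] := morph_umagma (@gmulfM _ _ phi); apply: gmulfV. Qed.

Lemma phi_normal x (h : H) : exists y, phi y = phi x ^ h.
Proof.
apply/phi_derived => A [sA cA].
have [A1 AF] := sA.
have Ax : A (phi x) by apply: (proj2 (phi_derived (phi x))) => //; exists x.
have -> : phi x ^ h = phi x * [~ h, phi x]^-1
  by rewrite monoid.invgR commgEl mulVKg.
by apply: AF => //; apply: cA; exists h, (phi x).
Qed.

Definition act (h : H) (x : P) : P := sval (cid (phi_normal x h)).

Lemma phi_act h x : phi (act h x) = phi x ^ h.
Proof. exact: svalP (cid (phi_normal x h)). Qed.

Lemma actM h : {morph act h : x y / x * y}.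
Proof.
by move=> x y; apply: phi_inj; rewrite gmulfM !phi_act gmulfM conjMg.
Qed.

Lemma act_mul h k x : act (h * k) x = act k (act h x).
Proof. by apply: phi_inj; rewrite !phi_act conjgM. Qed.

Lemma act1 x : act 1 x = x.
Proof. by apply: phi_inj; rewrite phi_act conjg1. Qed.

Lemma act_phi x y : act (phi y) x = x ^ y.
Proof. by apply: phi_inj; rewrite phi_act phiJ. Qed.

Lemma act_inj h : injective (act h).
Proof. by move=> x y xy; rewrite -[x]act1 -[y]act1 -(mulgV h) !act_mul xy. Qed.

Lemma act_surj h y : exists x, act h x = y.
Proof. by exists (act h^-1 y); rewrite -act_mul mulVg act1. Qed.

Lemma act_axial h n g : axial n g -> exists m, axial m (act h g).
Proof. exact: automorphism_axial (actM h) (@act_inj h) (act_surj h) n g. Qed.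

(** This is a right action, since h acts by x |-> x ^ h. *)
Definition move_axis (h : H) (n : I) : I :=
  sval (cid (act_axial h (axial_delta n))).

Definition flip (h : H) (n : I) : bool :=
  act h (delta n r) (move_axis h n) != r.

Lemma move_axisP h n : axial (move_axis h n) (act h (delta n r)).
Proof. exact: svalP (cid (act_axial h (axial_delta n))). Qed.

Lemma act_axial_coordinate h n g : axial n g ->
  axial (move_axis h n) (act h g) /\
  act h g (move_axis h n) = if flip h n then (g n)^-1 else g n.
Proof.
move=> g_axial; rewrite /flip if_neg.
exact: (automorphism_axial_coordinate (actM h) (@act_inj h) (act_surj h)
  (move_axisP h n) g_axial).
Qed.

Lemma act_center h n (w : P) : (forall k, in_center (w k)) ->
  act h w (move_axis h n) = w n.
Proof.
exact: (automorphism_center_coordinate (actM h) (move_axisP h n)).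
Qed.

Lemma move_axisM h k n : move_axis (h * k) n = move_axis k (move_axis h n).
Proof.
apply: (axial_at _ (move_axisP _ _).1).
by rewrite act_mul; have [] := act_axial_coordinate k (move_axisP h n).
Qed.

Lemma flipE h n : flip h n = (act h (delta n r) (move_axis h n) == r^-1).
Proof.
rewrite /flip; have [/rotationP[]-> _] := move_axisP h n; rewrite eqxx /=.
  by apply/esym/eqP/nesym/r_inv_neq.
by apply/eqP/r_inv_neq.
Qed.

(** The cocycle identity satisfied by the signs of signed permutations. *)
Lemma flipM h k n : flip (h * k) n = flip h n (+) flip k (move_axis h n).
Proof.
have [_] := act_axial_coordinate k (move_axisP h n).
rewrite [flip (h * k) n]flipE move_axisM act_mul => ->.
have -> : act h (delta n r) (move_axis h n) = if flip h n then r^-1 else r.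
  by have [_ ->] := act_axial_coordinate h (axial_delta n); rewrite deltaE.
have rr : (r == r^-1) = false by apply/eqP => /esym/r_inv_neq.
by case: (flip h n); case: (flip k _); rewrite ?invgK ?eqxx ?rr.
Qed.

Lemma move_axis_phi y n : move_axis (phi y) n = n.
Proof.
apply/esym; apply: (axial_at (move_axisP _ _)); rewrite act_phi.
by change ((delta n r n ^ y n) ^+ 2 <> 1); rewrite deltaE; apply: rotationJ.
Qed.

Lemma flip_phi y n : flip (phi y) n = (r ^ y n != r).
Proof.
rewrite /flip move_axis_phi act_phi.
by change ((delta n r n ^ y n != r) = (r ^ y n != r)); rewrite deltaE.
Qed.

Lemma move_axis1 n : move_axis 1 n = n.
Proof. by rewrite -[1](@mulgV _ (phi 1)) -phiV -gmulfM move_axis_phi. Qed.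

Lemma move_axis_inj h : injective (move_axis h).
Proof.
move=> m n mn.
by rewrite -[m]move_axis1 -[n]move_axis1 -(mulgV h) !move_axisM mn.
Qed.

Lemma commg_in_derived (h k : H) : exists y, phi y = [~ h, k].
Proof. by apply/phi_derived => A [_]; apply; exists h, k. Qed.

(** The action on the axes factors through the abelianization of H, as the
derived subgroup acts by inner automorphisms of P. *)
Lemma move_axisC h k n :
  move_axis h (move_axis k n) = move_axis k (move_axis h n).
Proof.
have [y hk] := commg_in_derived k h.
by rewrite -!move_axisM (commgC k h) move_axisM -hk move_axis_phi.
Qed.

Lemma move_axisX h k n : move_axis (h ^+ k) n = iter k (move_axis h) n.
Proof.
elim: k n => [|k IH] n; first by rewrite expg0 move_axis1.
by rewrite expgSr move_axisM IH.
Qed.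

(** * Orbits of single elements under residual finiteness *)

(** For an infinite orbit, t and w below satisfy [~ w, t] = delta i z while t is
killed by the finite quotient. *)
Lemma residually_finite_periodic : residually_finite H ->
  forall h n, exists2 k, 0 < k & iter k (move_axis h) n = n.
Proof.
move=> rfH h i; apply: contrapT => no_period.
have wander k : 0 < k -> iter k (move_axis h) i <> i.
  by move=> k_gt0 ki; apply: no_period; exists k.
have iz : phi (delta i z) <> 1.
  have [a phiE] := morph_umagma (@gmulfM _ _ phi).
  move=> iz; have : delta i z = 1.
    by apply: phi_inj; rewrite iz -phiE gmulf1.
  by move=> /(congr1 (fun x : P => x i)); rewrite deltaE.
have [K [f fz]] := rfH _ iz.
pose t := h ^+ #[f h].
have ft : f t = 1.
  have [a fE] := morph_umagma (@gmulfM _ _ f).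
  by rewrite -fE gmulfXn fE expg_order.
have tX j : iter j (move_axis t) i = iter (#[f h] * j)%N (move_axis h) i.
  by rewrite -!move_axisX -expgnA.
pose w : P := fun m =>
  if `[< exists j, m = iter j (move_axis t) i >] then z else 1.
have w_center k : in_center (w k) by rewrite /w; case: ifP; [right|left].
(* Conjugation by t shifts w one step along the orbit, which changes it only at
   the starting point i. *)
have wt : act t w = w * delta i z.
  apply: functional_extensionality_dep => m.
  change (act t w m = w m * delta i z m).
  pose n := move_axis t^-1 m.
  have -> : m = move_axis t n by rewrite /n -move_axisM mulVg move_axis1.
  rewrite act_center // /w /delta.
  have [ni|/eqP ni] := eqVneq (move_axis t n) i.
    have -> : `[< exists j, move_axis t n = iter j (move_axis t) i >].
      by apply/asboolP; exists 0.
    case: asboolP => [[j nj]|_]; last by rewrite z_sq.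
    case: (@wander (#[f h] * j.+1)%N); first by rewrite muln_gt0 order_gt0.
    by rewrite -tX iterS -nj.
  rewrite mulg1; congr (if _ then _ else _); apply: asbool_equiv_eq.
  split=> [[j ->]|[[|j] nj]]; first by exists j.+1.
    by [].
  by exists j; apply: move_axis_inj nj.
apply: fz.
have -> : delta i z = w^-1 * act t w by rewrite wt mulKg.
rewrite !gmulfM phi_act phiV.
have [a fE] := morph_umagma (@gmulfM _ _ f).
by rewrite -fE gmulfV gmulfJ fE ft conjg1 mulVg.
Qed.

(** * Signs on finite stable sets *)

Definition stable (L : seq H) (O : seq I) : Prop :=
  uniq O /\ {in L & O, forall h n, move_axis h n \in O}.

(** Signs are booleans, true standing for -1, so that products become xors. *)
Definition sign (O : seq I) (h : H) : bool :=
  \big[addb/false]_(n <- O) flip h n.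

(** Reindexing the second half of the cocycle identity along the permutation of
O induced by h. *)
Lemma sign_mul h k O : stable [:: h] O ->
  sign O (h * k) = sign O h (+) sign O k.
Proof.
move=> [O_uniq Oh]; rewrite /sign.
under eq_bigr do rewrite flipM.
rewrite big_split /=; congr (_ (+) _).
rewrite -(big_map (move_axis h) xpredT (flip k)).
apply: perm_big.
have sub : {subset [seq move_axis h n | n <- O] <= O}.
  by move=> _ /mapP[n On ->]; apply: Oh; rewrite ?inE.
have mapO_uniq : uniq [seq move_axis h n | n <- O].
  by rewrite map_inj_uniq //; apply: move_axis_inj.
by apply: uniq_perm => //; have [] := uniq_min_size mapO_uniq sub;
  rewrite ?size_map.
Qed.

Lemma stable_phi y O : uniq O -> stable [:: phi y] O.
Proof.
by move=> O_uniq; split=> // h n; rewrite inE => /eqP ->; rewrite move_axis_phi.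
Qed.

(** The finite list L depends on an expression of x as a product of
commutators; elements with such a list form a subgroup that contains all
commutators. *)
Lemma derived_sign_trivial (x : H) : derived_set x ->
  exists L, forall O, stable L O -> sign O x = false.
Proof.
pose A x := derived_set x /\ exists L, forall O, stable L O -> sign O x = false.
move=> /(_ A) [] //; split; last first.
  move=> _ [h [k ->]]; have [y hk] := commg_in_derived h k.
  split; first by apply/phi_derived; exists y.
  exists [:: h; k] => O [O_uniq OL].
  have [Oh Ok] : stable [:: h] O /\ stable [:: k] O.
    split; split=> // l n; rewrite inE => /eqP-> On;
      by apply: OL; rewrite // !inE eqxx ?orbT.
  have := congr1 (sign O) (commgC h k).
  rewrite -hk -mulgA !sign_mul // => /esym.
  by case: (sign O h); case: (sign O k); case: (sign O _).
have sub_derived : is_subgroup (@derived_set H).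
  split=> [B [[]] //|u v Du Dv B [sB cB]].
  by apply: sB.2; [apply: Du|apply: Dv].
have sign1 O : uniq O -> sign O 1 = false.
  move=> O_uniq; have O1 : stable [:: (1 : H)] O.
    by split=> // h n; rewrite inE => /eqP ->; rewrite move_axis1.
  by have := sign_mul 1 O1; rewrite mulg1; case: (sign O 1).
split.
  split; first exact: sub_derived.1.
  by exists [::] => O [/sign1].
move=> u v [Du [Lu signu]] [Dv [Lv signv]].
split; first exact: sub_derived.2.
exists (Lu ++ Lv) => O [O_uniq OL].
have stab_derived a : derived_set a -> stable [:: a] O.
  by move=> /phi_derived[y <-]; apply: stable_phi.
have stable_sub L : {subset L <= Lu ++ Lv} -> stable L O.
  by move=> sub; split=> // h n /sub; apply: OL.
have Lu_stable : stable Lu O by apply: stable_sub => h; rewrite mem_cat => ->.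
have Lv_stable : stable Lv O.
  by apply: stable_sub => h; rewrite mem_cat orbC => ->.
have := sign1 _ O_uniq; rewrite -(mulgV v).
rewrite !(sign_mul _ (stab_derived _ _)) // (signu O Lu_stable).
by rewrite (signv O Lv_stable).
Qed.

(** Since the permutations commute, applying the powers of one more element h to
a finite set stable under L yields a set still stable under L. *)
Lemma periodic_stable :
    (forall h n, exists2 k, 0 < k & iter k (move_axis h) n = n) ->
  forall (L : seq H) i, exists2 O, stable L O & i \in O.
Proof.
move=> periodic L i; elim: L => [|h L [O [_ OL] Oi]].
  by exists [:: i]; rewrite ?inE.
have {}periodic n : exists k, 0 < k /\ iter k (move_axis h) n = n.
  by have [k] := periodic h n; exists k.
have [p pP] := boolp.choice periodic.
pose f := move_axis h.
pose O' := undup [seq iter j f n | n <- O, j <- iota 0 (p n)].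
have mem_O' n j : n \in O -> iter j f n \in O'.
  move=> On; have [p_gt0 pn] := pP n.
  (* Exponents are taken modulo the period p n to keep the set finite. *)
  have -> : iter j f n = iter (j %% p n) f n.
    by rewrite {1}(divn_eq j (p n)) addnC iterD iterM (iter_fix (j %/ p n) pn).
  rewrite mem_undup; apply/allpairsPdep; exists n, (j %% p n).
  by rewrite mem_iota ltn_pmod.
exists O'; last exact: (mem_O' i 0).
split; first exact: undup_uniq.
move=> l m; rewrite inE mem_undup => /predU1P lL /allpairsPdep[n [j [On _ ->]]].
have [->|{}lL] := lL; first exact: (mem_O' n j.+1).
have -> : move_axis l (iter j f n) = iter j f (move_axis l n).
  by rewrite /f -!move_axisX move_axisC.
by apply: mem_O'; apply: OL.
Qed.

(** The reflection at i would have trivial sign on a finite set containing i,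
though i is the only axis that it flips. *)
Lemma not_residually_finite (i : I) : ~ residually_finite H.
Proof.
move=> /residually_finite_periodic/periodic_stable stable_exists.
have /derived_sign_trivial[L signL] : derived_set (phi (delta i s)).
  by apply/phi_derived; exists (delta i s).
have [O OL Oi] := stable_exists L i.
have := signL _ OL; rewrite /sign (bigD1_seq i) ?OL.1 //=.
rewrite flip_phi deltaE big1 => [|n /eqP ni]; last first.
  by rewrite flip_phi delta_neq // conjg1 eqxx.
by rewrite addbF => /negbFE; rewrite conjg_fix rs => /eqP/z_neq1.
Qed.
End Integral.
End DihedralPair.

(** * Integrals of an unrestricted power of D8 *)

Theorem proposition8p13 (G : int -> groupType)
    (hG : forall n : int, isomorphic (G n) ('D_8)%type)
    (H : groupType) :
  is_integral H (cartesian_product G) -> ~ residually_finite H.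
Proof.
move=> intH.
have [r [s rsP]] := isog_D8_dihedral_pair (isog_refl [set: 'D_8]%G).
have [f [g fK gK]] :=
  isomorphic_sym (isomorphic_trans intH (isomorphic_prod hG)).
pose phi : {multiplicative cartesian_product (fun _ : int => 'D_8) -> H} :=
  (val : derived_group H -> H) \o f.
apply: (@not_residually_finite _ _ _ rsP _ _ phi _ _ 0%R).
  by move=> x y /val_inj; apply: (can_inj fK).
move=> x; split=> [/asboolP Dx|[y <-]].
  by exists (g (DerivedGroup Dx)); rewrite /= gK.
exact/asboolP/(valP (f y)).
Qed.
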